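(* Let $(M,F)$ be a conic pseudo-Finsler surface with $F$ defined on the conic sub-bundle $\mathcal A$, let $\phi$ be a smooth function of position $x$ only, and let $\overline F=e^{\phi}F$. Then: (i) $\overline g_{ij}=e^{2\phi}g_{ij}$ and $\overline g^{ij}=e^{-2\phi}g^{ij}$; (ii) $\overline\ell^{\,i}=e^{-\phi}\ell^i$ and $\overline\ell_i=e^{\phi}\ell_i$; (iii) $\overline m_i=e^{\phi}m_i$, $\overline m^{\,i}=e^{-\phi}m^i$ and $\overline h_{ij}=e^{2\phi}h_{ij}$; (iv) $\overline C_{ijk}=e^{2\phi}C_{ijk}$, $\overline C^{\,i}_{jk}=C^i_{jk}$ and $\overline{\mathcal I}=\mathcal I$; (v) $\overline G^i=G^i+\tfrac12F^2(\phi_{,1}\,\ell^i-\phi_{,2}\,m^i)$.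
   Context: Let $M$ be a smooth 2-dimensional manifold, $(x^1,x^2)$ local coordinates and $(x^i,y^i)$ the induced coordinates on $TM$; all formulas are in such a coordinate system and repeated indices are summed over $\{1,2\}$. Write $\partial_i=\partial/\partial x^i$, $\dot\partial_i=\partial/\partial y^i$. A conic sub-bundle is a non-empty open subset $\mathcal A\subset TM\setminus 0$ projecting onto $M$ and closed under multiplication by positive scalars. A conic pseudo-Finsler metric on $M$ is a smooth function $F:\mathcal A\to\mathbb R$, positively homogeneous of degree one in $y$, such that $g_{ij}=\tfrac12\dot\partial_i\dot\partial_jF^2$ is non-degenerate at each point of $\mathcal A$; $(g^{ij})$ is the inverse matrix. A conic pseudo-Finsler surface is equipped with its modified Berwald frame: $F$ is nowhere zero on $\mathcal A$, $\ell_i=\dot\partial_iF$, $\ell^i=y^i/F$, $\varepsilon\in\{1,-1\}$ (the signature) is the sign of $\det(g_{ij})$, $m_1=-\sqrt{\varepsilon\det(g_{ij})}\,\ell^2$, $m_2=\sqrt{\varepsilon\det(g_{ij})}\,\ell^1$, $m^i=g^{ij}m_j$; thus $g_{ij}=\ell_i\ell_j+\varepsilon m_im_j$, $\ell^im_i=0$, $m^im_i=\varepsilon$. The angular metric is $h_{ij}=F\dot\partial_i\dot\partial_jF$; the Cartan tensor is $C_{ijk}=\tfrac12\dot\partial_kg_{ij}$, $C^i_{jk}=g^{ih}C_{hjk}$, and the main scalar $\mathcal I$ is defined by $F\,C_{ijk}=\mathcal I\,m_im_jm_k$. The geodesic spray coefficients are $G^i=\tfrac14g^{ij}(y^k\dot\partial_j\partial_kF^2-\partial_jF^2)$;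 $G^j_i=\dot\partial_iG^j$, $\delta_i=\partial_i-G^j_i\dot\partial_j$. For a smooth function $f$ on $\mathcal A$: $f_{,1}:=(\delta_if)\ell^i$, $f_{,2}:=\varepsilon(\delta_if)m^i$ (frame of $F$). Barred objects are the corresponding objects built from $\overline F$. *)

(* Defs.v *)
From HB Require Import structures.
From mathcomp Require Import all_boot all_order all_algebra.
From mathcomp Require Import all_classical all_reals all_analysis.
From mathcomp Require Import ring.

Set Implicit Arguments.
Unset Strict Implicit.
Unset Printing Implicit Defensive.

Import Order.TTheory GRing.Theory Num.Theory numFieldNormedType.Exports.

Local Open Scope classical_set_scope.
Local Open Scope ring_scope.

(* C^k on an open set D. A map is C^(k+1) iff it is differentiable with a C^k
   differential; in finite dimension the differential is C^k iff all its
   evaluations, the directional derivatives, are. *)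
Fixpoint Ck_on (k : nat) (R : realType) (V W : normedModType R) (D : set V)
    (f : V -> W) : Prop :=
  if k is k'.+1 then
    (forall x, D x -> differentiable f x) /\
    (forall v, Ck_on k' D (fun x => 'D_v f x))
  else forall x, D x -> {for x, continuous f}.

Definition smooth_on (R : realType) (V W : normedModType R) (D : set V)
  (f : V -> W) : Prop := forall k, Ck_on k D f.

(* A chart a is [chart a] restricted to [dom a], with inverse [unchart a]. The
   atlas need not be maximal. *)
Record smooth_surface (R : realType) := SmoothSurface {
  point_of :> topologicalType;
  atlas : Type;
  dom : atlas -> set point_of;
  chart : atlas -> point_of -> 'rV[R]_2;
  unchart : atlas -> 'rV[R]_2 -> point_of;
  surface_hausdorff : hausdorff_space point_of;
  surface_second_countable : @second_countable point_of;
  dom_open : forall a, open (dom a);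
  codom_open : forall a, open (chart a @` dom a);
  chartK : forall a p, dom a p -> unchart a (chart a p) = p;
  chart_continuous : forall a p, dom a p -> {for p, continuous (chart a)};
  unchart_continuous : forall a x, (chart a @` dom a) x ->
    {for x, continuous (unchart a)};
  dom_cover : forall p, exists a, dom a p;
  transition_smooth : forall a b,
    smooth_on (chart a @` (dom a `&` dom b)) (chart b \o unchart a) }.

(* A tangent vector, given by its components in every chart around its base
   point; these are related by the differentials of the transition maps. The
   components in the other charts carry no information and are set to 0. *)
Record tangent (R : realType) (M : smooth_surface R) := Tangent {
  base : M;
  comp : atlas M -> 'rV[R]_2;
  comp_out : forall a, ~ dom a base -> comp a = 0;
  comp_transition : forall a b, dom a base -> dom b base ->
    comp b = 'D_(comp a) (chart b \o unchart a) (chart a base) }.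

Section TangentBundle.
Context (R : realType) (M : smooth_surface R).
Implicit Types (a b : atlas M) (u v w : tangent M) (A : set (tangent M)).

(* The induced coordinates (x, y) on TM. *)
Definition coords a w : 'rV[R]_2 * 'rV[R]_2 := (chart a (base w), comp w a).

Definition coord_image a A : set ('rV[R]_2 * 'rV[R]_2) :=
  coords a @` [set w | A w /\ dom a (base w)].

(* The expression in the coordinates (x, y) of a function on TM; it is
   meaningful on the image of the coordinates: see [loc_coords], and
   [coords_onto] for what that image is. *)
Definition loc a (H : tangent M -> R) (z : 'rV[R]_2 * 'rV[R]_2) : R :=
  get [set r | exists w, [/\ dom a (base w), coords a w = z & r = H w]].

(* v = c w, with c a scalar. *)
Definition is_scaled (c : R) w v : Prop :=
  base v = base w /\ forall a, comp v a = c *: comp w a.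

Definition smooth_function (phi : M -> R) : Prop :=
  forall a, smooth_on (chart a @` dom a) (phi \o unchart a).

(* The first condition is that A is open in TM. *)
Definition conic_subbundle A : Prop :=
  [/\ forall a, open (coord_image a A),
      A !=set0,
      forall w a, A w -> dom a (base w) -> comp w a != 0,
      forall p : M, exists2 w, A w & base w = p &
      forall c w v, 0 < c -> is_scaled c w v -> A w -> A v].

End TangentBundle.

(* Geometric objects of a function F of (x, y), in coordinates. The indices
   1, 2 are 0, 1 : 'I_2. *)
Section LocalFinsler.
Context (R : realType).
Implicit Types (F f : 'rV[R]_2 * 'rV[R]_2 -> R) (z : 'rV[R]_2 * 'rV[R]_2).
Implicit Types i j k h : 'I_2.

Definition dx i f z : R := 'D_(delta_mx 0 i, 0) f z.
Definition dy i f z : R := 'D_(0, delta_mx 0 i) f z.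

Definition sqf F z : R := F z ^+ 2.

Definition gmx F z : 'M[R]_2 := \matrix_(i, j) (2^-1 * dy i (dy j (sqf F)) z).
Definition g_lo F i j z : R := gmx F z i j.
Definition g_up F i j z : R := invmx (gmx F z) i j.

Definition ell_lo F i z : R := dy i F z.
Definition ell_up F i z : R := z.2 0 i / F z.

Definition signature F z : R := Num.sg (\det (gmx F z)).

Definition m_lo F i z : R :=
  if i == 0 then - (Num.sqrt (signature F z * \det (gmx F z)) * ell_up F 1 z)
  else Num.sqrt (signature F z * \det (gmx F z)) * ell_up F 0 z.
Definition m_up F i z : R := \sum_j g_up F i j z * m_lo F j z.

Definition angular F i j z : R := F z * dy i (dy j F) z.

Definition cartan F i j k z : R := 2^-1 * dy k (g_lo F i j) z.
Definition cartan_up F i j k z : R := \sum_h g_up F i h z * cartan F h j k z.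

Definition main_scalar F z : R :=
  get [set I | forall i j k,
    F z * cartan F i j k z = I * m_lo F i z * m_lo F j z * m_lo F k z].

Definition spray F i z : R :=
  4^-1 * \sum_j g_up F i j z *
    (\sum_k z.2 0 k * dy j (dx k (sqf F)) z - dx j (sqf F) z).

(* [nonlinear F j i] is G^j_i. *)
Definition nonlinear F j i z : R := dy i (spray F j) z.

Definition delta F i f z : R :=
  dx i f z - \sum_j nonlinear F j i z * dy j f z.

(* f_{,1} and f_{,2} *)
Definition hder1 F f z : R := \sum_i delta F i f z * ell_up F i z.
Definition hder2 F f z : R :=
  signature F z * \sum_i delta F i f z * m_up F i z.

End LocalFinsler.

Section ConicPseudoFinsler.
Context (R : realType) (M : smooth_surface R).

(* Only the values of F on A matter. *)
Definition conic_pseudo_finsler (A : set (tangent M)) (F : tangent M -> R) :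
    Prop :=
  [/\ conic_subbundle A,
      forall a, smooth_on (coord_image a A) (loc a F),
      forall c w v, 0 < c -> is_scaled c w v -> A w -> F v = c * F w,
      forall a z, coord_image a A z -> \det (gmx (loc a F) z) != 0 &
      forall w, A w -> F w != 0].

End ConicPseudoFinsler.

Section TangentBundleTheory.
Context (R : realType) (M : smooth_surface R).
Implicit Types (a b c : atlas M) (u v w : tangent M) (A : set (tangent M)).

Lemma coords_inj a v w : dom a (base v) -> dom a (base w) ->
  coords a v = coords a w -> v = w.
Proof.
case: v => p f f0 fT; case: w => q g g0 gT /= ap aq.
rewrite /coords/= => -[epq efg].
have {epq} epq : p = q by rewrite -(chartK ap) epq chartK.
subst q; have {efg} efg : f = g.
  apply/funext => b; have [bp|bp] := pselect (dom b p).
    by rewrite (fT a b)// (gT a b)// efg.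
  by rewrite f0// g0.
by subst g; congr Tangent; exact: Prop_irrelevance.
Qed.

Lemma loc_coords a (H : tangent M -> R) w : dom a (base w) ->
  loc a H (coords a w) = H w.
Proof.
move=> aw; apply: (@xget_subset1 _ _ [set r | exists v,
    [/\ dom a (base v), coords a v = coords a w & r = H v]]).
  by exists w.
by move=> _ _ [u [au /(coords_inj au aw)-> ->]] [v [av /(coords_inj av aw)-> ->]].
Qed.

Lemma unchart_near a b p : dom a p -> dom b p ->
  \forall x \near chart a p, dom b (unchart a x).
Proof.
move=> ap bp; apply: (unchart_continuous (a := a) (x := chart a p)).
  by exists p.
by rewrite chartK//; apply: open_nbhs_nbhs; split => //; exact: dom_open.
Qed.

Lemma transition_differentiable a b p : dom a p -> dom b p ->
  differentiable (chart b \o unchart a) (chart a p).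
Proof.
move=> ap bp; have [d _] := @transition_smooth R M a b 1%N.
by apply: d; exists p.
Qed.

Lemma transition_cocycle a b c p (y : 'rV[R]_2) :
  dom a p -> dom b p -> dom c p ->
  'D_('D_y (chart b \o unchart a) (chart a p)) (chart c \o unchart b) (chart b p)
  = 'D_y (chart c \o unchart a) (chart a p).
Proof.
move=> ap bp cp.
have dab := transition_differentiable ap bp.
have dbc := transition_differentiable bp cp.
have e : chart b p = (chart b \o unchart a) (chart a p) by rewrite /= chartK.
have dbc' := dbc; rewrite e in dbc'.
have -> : 'D_y (chart c \o unchart a) (chart a p) =
    'D_y ((chart c \o unchart b) \o (chart b \o unchart a)) (chart a p).
  apply: near_eq_derive => //.
  by apply: filterS (unchart_near ap bp) => x /= bx; rewrite chartK.
rewrite [RHS]deriveE; last exact: differentiable_comp.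
by rewrite diff_comp//= -deriveE// -deriveE// chartK.
Qed.

Lemma coords_onto a p (y : 'rV[R]_2) : dom a p ->
  exists w, base w = p /\ coords a w = (chart a p, y).
Proof.
move=> ap.
pose f b := if pselect (dom b p) then 'D_y (chart b \o unchart a) (chart a p) else 0.
have fE b : dom b p -> f b = 'D_y (chart b \o unchart a) (chart a p).
  by rewrite /f; case: pselect.
have f0 b : ~ dom b p -> f b = 0 by rewrite /f; case: pselect.
have fT b c : dom b p -> dom c p ->
    f c = 'D_(f b) (chart c \o unchart b) (chart b p).
  by move=> bp cp; rewrite !fE// transition_cocycle.
exists (Tangent f0 fT); split => //; rewrite /coords/= fE//.
congr pair.
rewrite -[RHS](derive_id (chart a p)).
apply: near_eq_derive => //.
have /open_nbhs_nbhs : open_nbhs (chart a p) (chart a @` dom a).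
  by split; [exact: codom_open | exists p].
by apply: filterS => _ [q aq <-] /=; rewrite chartK.
Qed.

End TangentBundleTheory.

Lemma near_eq_diff (R : realType) (V W : normedModType R) (f g : V -> W) x :
  (\forall y \near x, f y = g y) -> differentiable f x -> differentiable g x.
Proof.
move=> fg df; have fgx : f x = g x := nbhs_singleton fg.
have cd : continuous ('d f x) by exact: diff_continuous.
suff gE : g \o shift x = cst (g x) + 'd f x +o_ 0 id.
  by apply/diff_locallyP; rewrite (diff_unique cd gE).
apply/eqaddoP => e e0.
have /diff_locallyP[_ /eqaddoP/(_ e e0)] := df.
move: fg; rewrite (near_shift 0) subr0 => fg.
apply: filterS2 fg => y /= fgy; rewrite -fgx.
rewrite !fctE/= in fgy *; rewrite -fgy.
by [].
Qed.

Section Smooth.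
Context (R : realType) (V : normedModType R) (D : set V).
Hypothesis oD : open D.
Implicit Types f g : V -> R.

Lemma near_open (P : V -> Prop) x : D x -> (forall y, D y -> P y) ->
  \forall y \near x, P y.
Proof.
by move=> Dx DP; apply: filterS DP _; apply: open_nbhs_nbhs.
Qed.

Lemma Ck_on_eq k f g : (forall y, D y -> f y = g y) -> Ck_on k D f -> Ck_on k D g.
Proof.
elim: k f g => [|k IH] f g fg /=.
  move=> cf x Dx; have fgn := near_open Dx fg.
  rewrite /prop_for/continuous_at -fg//.
  apply: cvg_trans (cf _ Dx); apply: near_eq_cvg.
  by apply: filterS fgn.
move=> [df Df]; split=> [x Dx|v]; first exact: near_eq_diff (near_open Dx fg) (df _ Dx).
by apply: IH (Df v) => y Dy; apply: near_eq_derive; exact: near_open fg.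
Qed.

Lemma Ck_onW k f : Ck_on k.+1 D f -> Ck_on k D f.
Proof.
elim: k f => [|k IH] f [df Df].
  by move=> x Dx; apply: differentiable_continuous; exact: df.
by split => // v; exact: IH.
Qed.

Lemma Ck_onD k f g : Ck_on k D f -> Ck_on k D g -> Ck_on k D (fun x => f x + g x).
Proof.
elim: k f g => [|k IH] f g.
  by move=> cf cg x Dx; apply: cvgD; [exact: cf|exact: cg].
move=> [df Df] [dg Dg]; split => [x Dx|v].
  by apply: (@differentiableD _ _ _ f g); [exact: df|exact: dg].
apply: Ck_on_eq (IH _ _ (Df v) (Dg v)) => y Dy.
by rewrite (@deriveD _ _ _ f g)//; apply: diff_derivable; [exact: df|exact: dg].
Qed.

Lemma Ck_onM k f g : Ck_on k D f -> Ck_on k D g -> Ck_on k D (fun x => f x * g x).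
Proof.
elim: k f g => [|k IH] f g.
  by move=> cf cg x Dx; apply: cvgM; [exact: cf|exact: cg].
move=> /[dup] sf [df Df] /[dup] sg [dg Dg]; split => [x Dx|v].
  by apply: (@differentiableM _ _ f g); [exact: df|exact: dg].
apply: (Ck_on_eq _ (Ck_onD (IH _ _ (Ck_onW sf) (Dg v)) (IH _ _ (Ck_onW sg) (Df v)))).
move=> y Dy; rewrite (@deriveM _ _ f g)//; apply: diff_derivable; [exact: df|exact: dg].
Qed.

Lemma smooth_onM f g : smooth_on D f -> smooth_on D g ->
  smooth_on D (fun x => f x * g x).
Proof. by move=> sf sg k; apply: Ck_onM; [exact: sf|exact: sg]. Qed.

Lemma smooth_onX2 f : smooth_on D f -> smooth_on D (fun x => f x ^+ 2).
Proof. by move=> sf k; apply: Ck_on_eq (smooth_onM sf sf k) => y _; rewrite expr2. Qed.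

Lemma smooth_on_derive f v : smooth_on D f -> smooth_on D (fun x => 'D_v f x).
Proof. by move=> sf k; have [_ Df] := sf k.+1; exact: Df. Qed.

Lemma smooth_on_diff f x : D x -> smooth_on D f -> differentiable f x.
Proof. by move=> Dx sf; have [df _] := sf 1%N; exact: df. Qed.

End Smooth.

Section Euler.
Context (R : realType).
Local Notation T := ('rV[R]_2 * 'rV[R]_2)%type.
Context (D : set T).
Hypothesis oD : open D.
Hypothesis coneD : forall c z, 0 < c -> D z -> D (z.1, c *: z.2).
Implicit Types h q u : T -> R.

Definition homog n h := forall c z, 0 < c -> D z -> h (z.1, c *: z.2) = c ^+ n * h z.

Lemma sum_dy h z : differentiable h z ->
  \sum_k z.2 0 k * dy k h z = 'D_(0, z.2) h z.
Proof.
move=> dh; have -> : (0, z.2) = \sum_k z.2 0 k *: (0, delta_mx 0 k : 'rV[R]_2) :> T.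
  rewrite !big_ord_recl big_ord0/= addr0.
  apply/pair_equal_spec; split => /=; first by rewrite !scaler0 addr0.
  by rewrite {1}[z.2]row_sum_delta !big_ord_recl big_ord0 addr0.
rewrite deriveE// linear_sum; apply: eq_bigr => k _.
by rewrite linearZ/= /dy deriveE.
Qed.

Definition scale2 (c : R) (z : T) : T := (z.1, c *: z.2).

Lemma scale2_linear c : linear (scale2 c).
Proof.
move=> k [x y] [x' y']; rewrite /scale2/=; apply/pair_equal_spec; split => //=.
by rewrite scalerDr !scalerA mulrC.
Qed.

HB.instance Definition _ c := GRing.isLinear.Build _ _ _ _ _ (scale2_linear c).

Lemma scale2_continuous c : continuous (scale2 c).
Proof.
move=> z; rewrite /continuous_at /scale2.
have c2 : c *: x.2 @[x --> z] --> c *: z.2 by apply: cvgZl_tmp; exact: cvg_snd.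
have c1 : x.1 @[x --> z] --> z.1 by exact: cvg_fst.
by have := cvg_pair c1 c2; exact.
Qed.

Lemma euler n h z : D z -> differentiable h z -> homog n h ->
  \sum_k z.2 0 k * dy k h z = n%:R * h z.
Proof.
move=> Dz dh hh; rewrite sum_dy//.
have -> : 'D_(0, z.2) h z = 'D_1 (fun t : R => h (t *: (0, z.2) + z)) 0.
  rewrite /derive; apply: (f_equal (fun q : R -> R => lim (q x @[x --> 0^']))).
  apply/funext => t /=.
  by rewrite !addr0 scale0r add0r [t *: 1]mulr1.
have -> : 'D_1 (fun t : R => h (t *: (0, z.2) + z)) 0 =
    'D_1 (fun t : R => h z * (t + 1) ^+ n) 0.
  apply: near_eq_derive.
  near=> t; have t1 : 0 < t + 1.
    rewrite -ltrBlDr sub0r; near: t; apply: lt_nbhsr; by rewrite oppr_lt0.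
  rewrite mulrC -hh//; congr h; case: z {Dz dh} => x y.
  by apply/pair_equal_spec; split => /=; rewrite ?scaler0 ?add0r// scalerDl scale1r.
have -> : (fun t : R => h z * (t + 1) ^+ n) = h z \*: ((id + cst 1) ^+ n).
  by apply/funext => t; rewrite !fctE.
have d1 : is_derive (0 : R) 1 (id + cst 1 : R -> R) (1 + 0) by exact: is_deriveD.
have dn := @is_deriveX _ _ _ n _ _ _ d1.
have [dz e] := @is_deriveZ _ _ _ _ (h z) _ _ _ dn.
by rewrite e !fctE add0r expr1n addr0 mulr1 !scaler1 mulrC.
Unshelve. all: by end_near. Qed.

Lemma homog_dy n h j : (forall z, D z -> differentiable h z) -> homog n.+1 h ->
  homog n (dy j h).
Proof.
move=> dh hh c z c0 Dz.
have e : 'D_(0, delta_mx 0 j) (h \o scale2 c) z =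
   'D_(0, delta_mx 0 j) (c ^+ n.+1 \*: h) z.
  by apply: near_eq_derive; apply: (near_open oD Dz) => x Dx; rewrite /= hh.
have dz := dh z Dz.
have dS : differentiable (scale2 c) z by apply: linear_differentiable; exact: scale2_continuous.
have dSz : differentiable h (scale2 c z) by apply: dh; exact: coneD.
rewrite deriveZ in e; last exact: diff_derivable.
rewrite deriveE in e; last exact: differentiable_comp.
rewrite diff_comp//= diff_lin in e; last exact: scale2_continuous.
have eS : scale2 c (0, delta_mx 0 j) = c *: (0, delta_mx 0 j).
  by apply/pair_equal_spec; split; rewrite //= scaler0.
have {e} : 'd h (scale2 c z) (scale2 c (0, delta_mx 0 j)) =
  c ^+ n.+1 *: 'D_(0, delta_mx 0 j) h z by exact: e.
rewrite eS linearZ/= -deriveE// => e.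
apply: (mulfI (lt0r_neq0 c0)); rewrite mulrA -exprS; exact: e.
Qed.

Definition fibre_coord i (z : T) : R := z.2 0 i.

Lemma fibre_coord_linear i : linear_for *%R (fibre_coord i).
Proof. by move=> k x y; rewrite /fibre_coord/= !mxE. Qed.

HB.instance Definition _ i :=
  GRing.isLinear.Build _ _ _ _ _ (fibre_coord_linear i).

Lemma fibre_coord_continuous i : continuous (fibre_coord i).
Proof.
move=> z; apply: (@continuous_comp _ _ _ snd (fun y : 'rV[R]_2 => y 0 i)).
  exact: cvg_snd.
exact: coord_continuous.
Qed.

Lemma dy_contract (u : 'I_2 -> T -> R) s k z : D z ->
  (forall i, differentiable (u i) z) ->
  (forall x, D x -> \sum_i x.2 0 i * u i x = s x) ->
  \sum_i z.2 0 i * dy k (u i) z = dy k s z - u k z.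
Proof.
move=> Dz du us.
have dc i : differentiable (fibre_coord i) z.
  by apply: linear_differentiable; exact: fibre_coord_continuous.
have Dc i : dy k (fibre_coord i) z = (i == k)%:R.
  rewrite /dy deriveE// diff_lin; last exact: fibre_coord_continuous.
  by rewrite /= /fibre_coord/= mxE eqxx.
have -> : dy k s z = dy k (\sum_i (fun x : T => fibre_coord i x * u i x)) z.
  apply: near_eq_derive; apply: (near_open oD Dz) => x Dx.
  by rewrite fct_sumE us.
rewrite /dy derive_sum; last first.
  by move=> i; apply: (@derivableM _ _ (fibre_coord i) (u i)); apply: diff_derivable.
have E i : 'D_(0, delta_mx 0 k) (fun x : T => fibre_coord i x * u i x) z =
    z.2 0 i * dy k (u i) z + u i z * (i == k)%:R.
  rewrite (@deriveM _ _ (fibre_coord i) (u i)); try exact: diff_derivable.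
  by rewrite -[X in u i z *: X]/(dy k (fibre_coord i) z) Dc.
under [in RHS]eq_bigr do rewrite E.
rewrite big_split/= -addrA -[LHS]addr0; congr (_ + _).
apply/esym/eqP; rewrite subr_eq0; apply/eqP.
rewrite (bigD1 k)//= eqxx mulr1 big1 ?addr0// => i /negPf ->; exact: mulr0.
Qed.

Section MainScalar.
Context (F : T -> R).
Hypotheses (sF : smooth_on D F) (hF : homog 1 F).
Hypotheses (F0 : forall z, D z -> F z != 0)
  (det0 : forall z, D z -> \det (gmx F z) != 0)
  (y0 : forall z, D z -> z.2 != 0).

Let perp (y : 'rV[R]_2) (i : 'I_2) : R := if i == 0 then - y 0 1 else y 0 0.

Let perpP (y : 'rV[R]_2) (v : 'I_2 -> R) a i : \sum_j y 0 j * v j = 0 ->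
  perp y a * v i = perp y i * v a.
Proof.
rewrite !big_ord_recl big_ord0 addr0 (_ : lift ord0 ord0 = 1)//; last exact/val_inj.
move=> /(canRL (addrK _)); rewrite sub0r => e.
have ordE (P : 'I_2 -> Prop) : P 0 -> P 1 -> forall k, P k.
  by move=> P0 P1 [[|[|//]] hk]; [move: P0|move: P1]; congr P; exact/val_inj.
move: a i; apply: (ordE) => [|]; apply: (ordE); rewrite /perp//= ?mulNr.
- by rewrite e.
- by rewrite e.
Qed.

Let perp_neq0 (y : 'rV[R]_2) : y != 0 -> exists a, perp y a != 0.
Proof.
move=> yn0; apply: contrapT => H; move/eqP: yn0; apply; apply/rowP.
have h a : perp y a = 0 by apply: contrapT => /eqP pa; apply: H; exists a.
have := h 0; have := h 1; rewrite /perp/= => h0 /eqP; rewrite oppr_eq0 => /eqP h1.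
move=> [[|[|//]] hk]; rewrite mxE.
  by rewrite -[RHS]h0; congr (y _ _); exact/val_inj.
by rewrite -[RHS]h1; congr (y _ _); exact/val_inj.
Qed.

Let m_loE i z : m_lo F i z =
  Num.sqrt `|\det (gmx F z)| / F z * perp z.2 i.
Proof.
rewrite /m_lo /signature /ell_up /perp normrEsg; case: ifP => _.
  by rewrite mulrN mulrA mulrAC.
by rewrite mulrA mulrAC.
Qed.

Lemma main_scalar_exists z : D z -> exists I, forall i j k,
  F z * cartan F i j k z = I * m_lo F i z * m_lo F j z * m_lo F k z.
Proof.
move=> Dz.
pose q := sqf F; pose dq j := dy j q; pose ddq i j := dy i (dq j).
have sq : smooth_on D q by exact: (smooth_onX2 oD sF).
have sdq j : smooth_on D (dq j) by exact: smooth_on_derive.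
have sddq i j : smooth_on D (ddq i j) by exact: smooth_on_derive.
have hq : homog 2 q by move=> c x c0 Dx; rewrite /q /sqf hF// exprMn expr1.
have dfq x : D x -> differentiable q x by move=> Dx; exact: smooth_on_diff sq.
have dfdq j x : D x -> differentiable (dq j) x.
  by move=> Dx; exact: smooth_on_diff (sdq j).
have dfddq i j x : D x -> differentiable (ddq i j) x.
  by move=> Dx; exact: smooth_on_diff (sddq i j).
have hdq j : homog 1 (dq j) by apply: homog_dy.
have hddq i j : homog 0 (ddq i j) by apply: homog_dy => //; exact: dfdq.
pose t i j k := dy k (ddq i j) z.
have slot3 i j : \sum_k z.2 0 k * t i j k = 0.
  by rewrite (euler Dz (dfddq i j z Dz) (hddq i j)) mul0r.
have slot1 j k : \sum_i z.2 0 i * t i j k = 0.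
  rewrite (@dy_contract (fun i => ddq i j) (dq j))//.
  - by rewrite subrr.
  - by move=> i; exact: dfddq.
  - by move=> x Dx; rewrite (euler Dx (dfdq j x Dx) (hdq j)) mul1r.
have slot2 i : \sum_j z.2 0 j * t i j i = 0.
  rewrite (@dy_contract (fun j => ddq i j) (dq i))//.
  - by rewrite subrr.
  - by move=> j; exact: dfddq.
  move=> x Dx; rewrite (@dy_contract dq (2%:R \*: q))//.
  - rewrite {1}/dy deriveZ; last by apply: diff_derivable; exact: dfq.
    by rewrite -/(dy i q x) -/(dq i x) scaler_nat mulr2n addrK.
  - by move=> j; exact: dfdq.
  - by move=> u Du; rewrite (euler Du (dfq u Du) hq).
have cE i j k : cartan F i j k z = 4^-1 * t i j k.
  rewrite /cartan; have -> : g_lo F i j = 2^-1 \*: ddq i j.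
    by apply/funext => x; rewrite /g_lo /gmx mxE.
  rewrite /dy deriveZ; last by apply: diff_derivable; exact: dfddq.
  rewrite -/(dy k _ z) -/(t i j k) -[2^-1 *: _]/(2^-1 * _) mulrA -invfM -natrM.
by [].
have [a pa] := perp_neq0 (y0 Dz).
set p := perp z.2 in pa.
have tE i j k : t i j k = p i * p j * p k * t a a a / p a ^+ 3.
  have e1 : p a * t i j k = p i * t a j k := perpP a i (slot1 j k).
  have e2 : p a * t a j k = p k * t a j a := perpP a k (slot3 a j).
  have e3 : p a * t a j a = p j * t a a a := perpP a j (slot2 a).
  apply: (canRL (mulfK _)); first by rewrite expf_neq0.
  transitivity (p a * (p a * (p a * t i j k))); first by ring.
  rewrite e1; transitivity (p a * p i * (p a * t a j k)); first by ring.
  by rewrite e2; transitivity (p i * p k * (p a * t a j a)); [ring|rewrite e3; ring].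
pose s := Num.sqrt `|\det (gmx F z)| / F z.
have s0 : s != 0.
  by rewrite mulf_neq0 ?invr_eq0 ?F0// sqrtr_eq0 -ltNge normr_gt0 det0.
exists (F z * 4^-1 * t a a a / (s * p a) ^+ 3) => i j k.
rewrite !m_loE -/s -/p cE tE.
by field; rewrite s0 pa.
Qed.

Lemma main_scalar_unique z I J : D z ->
  (forall i j k,
     F z * cartan F i j k z = I * m_lo F i z * m_lo F j z * m_lo F k z) ->
  (forall i j k,
     F z * cartan F i j k z = J * m_lo F i z * m_lo F j z * m_lo F k z) ->
  I = J.
Proof.
move=> Dz hI hJ; have [a pa] := perp_neq0 (y0 Dz).
have m0 : m_lo F a z != 0.
  rewrite m_loE !mulf_neq0// ?invr_eq0 ?F0//.
  by rewrite sqrtr_eq0 -ltNge normr_gt0 det0.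
have := hI a a a; rewrite hJ.
by do 3 (move/(mulIf m0)).
Qed.

End MainScalar.
End Euler.

Section ConicPseudoFinslerTheory.
Context (R : realType) (M : smooth_surface R).
Context (A : set (tangent M)) (F : tangent M -> R).
Hypothesis FA : conic_pseudo_finsler A F.

Lemma scaled_exists c (w : tangent M) : exists v, is_scaled c w v.
Proof.
have [a aw] := dom_cover (base w).
have [v [bv [_ vE]]] := coords_onto (c *: comp w a) aw.
exists v; split => // b; have [bw|bw] := pselect (dom b (base w)); last first.
  by rewrite !comp_out ?bv// scaler0.
rewrite (@comp_transition _ _ v a b) ?bv// (comp_transition aw bw) vE.
by rewrite !deriveE ?linearZ//; exact: transition_differentiable.
Qed.

(* The main scalar is well defined. *)
Lemma main_scalarP a w (f := loc a F) (z := coords a w) :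
  A w -> dom a (base w) ->
  (forall i j k, f z * cartan f i j k z =
    main_scalar f z * m_lo f i z * m_lo f j z * m_lo f k z) /\
  (forall I, (forall i j k, f z * cartan f i j k z =
    I * m_lo f i z * m_lo f j z * m_lo f k z) -> I = main_scalar f z).
Proof.
have [[oA _ A0 _ cA] sF hF dF nF] := FA.
move=> Aw aw; pose D := coord_image a A.
have Dz : D z by exists w.
have coneD c (x : 'rV[R]_2 * 'rV[R]_2) : 0 < c -> D x -> D (x.1, c *: x.2).
  move=> c0 [v [Av av] <-]; have [u uv] := scaled_exists c v.
  exists u; first by split; [exact: cA uv Av|rewrite uv.1].
  by rewrite /coords uv.1 uv.2.
have homf : homog D 1 f.
  move=> c x c0 [v [Av av] <-]; have [u uv] := scaled_exists c v.
  have -> : ((coords a v).1, c *: (coords a v).2) = coords a u.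
    by rewrite /coords uv.1 uv.2.
  by rewrite /f !loc_coords ?uv.1// (hF c v u).
have f0 x : D x -> f x != 0.
  by move=> [v [Av av] <-]; rewrite /f loc_coords// nF.
have y0 (x : 'rV[R]_2 * 'rV[R]_2) : D x -> x.2 != 0.
  by move=> [v [Av av] <-]; exact: A0.
have ex : exists I, forall i j k, f z * cartan f i j k z =
    I * m_lo f i z * m_lo f j z * m_lo f k z.
  by apply: (@main_scalar_exists _ D (oA a)) => //; [exact: sF|exact: dF].
have spec := getPex ex.
split => [i j k|I hI]; first exact: spec.
by apply: (@main_scalar_unique _ D f f0 _ y0 z) => //; exact: dF.
Qed.

End ConicPseudoFinslerTheory.

(* Main.v *)
Require Import Defs.
From mathcomp Require Import all_boot all_order all_algebra.
From mathcomp Require Import all_classical all_reals all_analysis.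
From mathcomp Require Import ring.

Import Order.TTheory GRing.Theory Num.Theory numFieldNormedType.Exports.

Local Open Scope classical_set_scope.
Local Open Scope ring_scope.

(* A function of position only is constant along the fibres, so e^{2 phi}
   passes through every fibre derivative of F^2: (i)-(iv) are then algebra.
   For (v), e^{-2 phi} g^ij turns the extra terms of the spray into
   (y^k phi_k) y^i - F^2 g^ij phi_j / 2, with phi_j the partial derivatives of
   phi; this is expanded in the frame by
   F^2 g^ij = y^i y^j + eps F^2 m^i m^j, which follows from Euler's identities
   g_ij y^j = (1/2) dF^2/dy^i and g_ij y^i y^j = F^2. *)

(** * Calculus of products with a factor depending on the base point only *)

Section BaseFunctions.
Context {R : realType} {V W : normedModType R}.
Implicit Types (e : V -> R) (u v : V * W -> R).

Lemma continuous_fst : continuous (fst : V * W -> V).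
Proof. by move=> z; exact: cvg_fst. Qed.

Lemma differentiable_fst (z : V * W) : differentiable (fst : V * W -> V) z.
Proof. by apply: linear_differentiable; exact: continuous_fst. Qed.

Lemma differentiable_comp_fst e z :
  differentiable e z.1 -> differentiable (fun x : V * W => e x.1) z.
Proof.
move=> de; apply: (@differentiable_comp _ _ _ _ fst e) => //.
exact: differentiable_fst.
Qed.

Lemma derive_comp_fst e (z : V * W) (h : V) (k : W) : differentiable e z.1 ->
  'D_(h, k) (fun x : V * W => e x.1) z = 'D_h e z.1.
Proof.
move=> de; rewrite deriveE; last exact: differentiable_comp_fst.
rewrite (@diff_comp _ _ _ _ fst e)//=; last exact: differentiable_fst.
by rewrite diff_lin ?deriveE//; exact: continuous_fst.
Qed.

(** Leibniz rule. The product formula for [v] is asked only near [z], because coordinate expressions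
    are controlled only on an open set. *)
Lemma derive_mul_base e u v (z : V * W) (h : V) (k : W) :
  differentiable e z.1 -> differentiable u z ->
  (\forall x \near z, v x = e x.1 * u x) ->
  'D_(h, k) v z = e z.1 * 'D_(h, k) u z + 'D_h e z.1 * u z.
Proof.
move=> de du vE; rewrite (near_eq_derive _ vE).
rewrite (@deriveM _ _ (fun x : V * W => e x.1) u).
- by rewrite derive_comp_fst// -[u z *: _]/(u z * _) [u z * _]mulrC.
- by apply: diff_derivable; exact: differentiable_comp_fst.
- exact: diff_derivable.
Qed.

(** A fibre direction has base component 0, which kills the term with the derivative of [e]. *)
Lemma derive_fibre_mul_base e u v (z : V * W) (k : W) :
  differentiable e z.1 -> differentiable u z ->
  (\forall x \near z, v x = e x.1 * u x) ->
  'D_(0, k) v z = e z.1 * 'D_(0, k) u z.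
Proof.
move=> de du vE; rewrite (derive_mul_base e u)//.
by rewrite [X in _ + X * _]deriveE// linear0 mul0r addr0.
Qed.

Lemma differentiable_expR e (x : V) : differentiable e x ->
  differentiable (fun t => expR (e t)) x.
Proof.
move=> de; apply: (@differentiable_comp _ _ _ _ e expR) => //.
exact/derivable1_diffP/derivable_expR.
Qed.

Lemma derive_expR_comp e (x h : V) : differentiable e x ->
  'D_h (fun t => expR (e t)) x = expR (e x) * 'D_h e x.
Proof.
move=> de; have dx : differentiable (@expR R) (e x).
  exact/derivable1_diffP/derivable_expR.
rewrite deriveE; last exact: differentiable_expR.
rewrite (@diff_comp _ _ _ _ e expR)//= diff1E//.
by rewrite derive1E derive_val deriveE// -[_ *: _]/(_ * _) mulrC.
Qed.

End BaseFunctions.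

(** * Linear algebra of 2x2 matrices *)

Section Matrix2.
Context {K : fieldType}.
Implicit Types A : 'M[K]_2.

Lemma ord2P (P : 'I_2 -> Prop) : P 0 -> P 1 -> forall i, P i.
Proof.
by move=> P0 P1 [[|[|//]] hi]; [move: P0|move: P1]; congr P; exact/val_inj.
Qed.

Lemma big_ord2 (f : 'I_2 -> K) : \sum_i f i = f 0 + f 1.
Proof.
by rewrite !big_ord_recl big_ord0 addr0; congr (_ + f _); exact/val_inj.
Qed.

Lemma det2E A : \det A = A 0 0 * A 1 1 - A 0 1 * A 1 0.
Proof.
rewrite (expand_det_row _ 0) big_ord2 /cofactor !det_mx11 !mxE/=.
have -> : lift 0 0 = 1 :> 'I_2 by exact/val_inj.
have -> : lift 1 0 = 0 :> 'I_2 by exact/val_inj.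
by rewrite expr0 mul1r expr1 mulN1r mulrN.
Qed.

Lemma sum_invmxl A (v : 'I_2 -> K) i : \det A != 0 ->
  \sum_j invmx A i j * (\sum_k A j k * v k) = v i.
Proof.
move=> dA; have Au : A \in unitmx by rewrite unitmxE unitfE.
have := mulmxA (invmx A) A (\col_k v k); rewrite mulVmx// mul1mx.
move/matrixP/(_ i 0); rewrite !mxE => <-.
by apply: eq_bigr => j _; rewrite mxE; under [in RHS]eq_bigr do rewrite mxE.
Qed.

(** Cramer's formula: the matrix on the right is the adjugate. In ['I_2] subtraction is modulo 2, so
    [1 - i] exchanges the two indices. *)
Lemma invmx2E A : \det A != 0 -> invmx A = (\det A)^-1 *:
  \matrix_(i, j) (if i == j then A (1 - i) (1 - j) else - A i j).
Proof.
move=> dA; have Au : A \in unitmx by rewrite unitmxE unitfE.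
set B := _ *: _; rewrite -[B]mul1mx -(mulVmx Au) -mulmxA.
suff -> : A *m B = 1%:M by rewrite mulmx1.
apply/matrixP; apply: ord2P; apply: ord2P;
rewrite !mxE !big_ord2 !mxE/= ?subrr ?subr0; move: dA; rewrite det2E => dA;
  by field.
Qed.

(* With n the vector y rotated by a right angle: A (y^T A y) =
   (A y) (A y)^T + det A n n^T, multiplied on both sides by the inverse of A. *)
Lemma invmx2_frame A (y n : 'I_2 -> K) i j :
  \det A != 0 -> A 0 1 = A 1 0 -> n 0 = - y 1 -> n 1 = y 0 ->
  (\sum_k y k * \sum_l A k l * y l) * invmx A i j =
  y i * y j + \det A * (\sum_k invmx A i k * n k) * (\sum_k invmx A j k * n k).
Proof.
move=> dA sA n0 n1; rewrite !big_ord2 n0 n1 invmx2E//.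
move: i j; apply: ord2P; apply: ord2P;
rewrite !mxE/= ?subrr ?subr0; move: dA; rewrite det2E sA => dA; by field.
Qed.

End Matrix2.

(** * Euler's identities and the frame decomposition for a single metric *)

Section LocalFrame.
Context {R : realType} {D : set ('rV[R]_2 * 'rV[R]_2)}.
Context {f : 'rV[R]_2 * 'rV[R]_2 -> R}.
Hypotheses (oD : open D)
  (coneD : forall c z, 0 < c -> D z -> D (z.1, c *: z.2))
  (sf : smooth_on D f) (hf : homog D 1 f)
  (f0 : forall z, D z -> f z != 0)
  (det0 : forall z, D z -> \det (gmx f z) != 0).
Implicit Types z : 'rV[R]_2 * 'rV[R]_2.

Let sq : smooth_on D (sqf f). Proof. exact: smooth_onX2. Qed.

Let sdq j : smooth_on D (dy j (sqf f)). Proof. exact: smooth_on_derive. Qed.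

Let hq : homog D 2 (sqf f).
Proof. by move=> c z c0 Dz; rewrite /sqf hf// exprMn expr1. Qed.

Let dq z : D z -> differentiable (sqf f) z.
Proof. by move=> Dz; exact: smooth_on_diff sq. Qed.

Let ddq j z : D z -> differentiable (dy j (sqf f)) z.
Proof. by move=> Dz; exact: smooth_on_diff (sdq j). Qed.

(** Doubling the fibre coordinate fixes a point with y = 0, so homogeneity would give F = 2F there,
    hence F = 0. *)
Lemma dir_neq0 z : D z -> z.2 != 0.
Proof.
move=> Dz; apply/eqP => z2; have /eqP := f0 _ Dz; apply.
have zE : (z.1, 2 *: z.2) = z by rewrite z2 scaler0 -z2 -surjective_pairing.
have /eqP : f z = 2 * f z by rewrite -{1}zE hf// ?ltr0n// expr1.
by rewrite mulr_natl mulr2n -subr_eq0 opprD addrA subrr sub0r oppr_eq0 => /eqP.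
Qed.

(** Differentiating Euler's identity for F^2, of degree two, along y^i leaves 2 - 1 = 1 copy of the
    derivative of F^2. *)
Lemma sum_gmx_dir z i : D z ->
  \sum_j g_lo f i j z * z.2 0 j = 2^-1 * dy i (sqf f) z.
Proof.
move=> Dz.
have E : \sum_j z.2 0 j * dy i (dy j (sqf f)) z = dy i (sqf f) z.
  rewrite (@dy_contract _ D oD (fun j => dy j (sqf f)) (2%:R \*: sqf f))//.
  - rewrite {1}/dy deriveZ; last by apply: diff_derivable; exact: dq.
    by rewrite -/(dy i (sqf f) z) scaler_nat mulr2n addrK.
  - by move=> j; exact: ddq.
  - by move=> x Dx; rewrite (euler Dx (dq _ Dx) hq).
rewrite -E mulr_sumr; apply: eq_bigr => j _.
by rewrite /g_lo mxE mulrAC mulrA.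
Qed.

(** Contraction of the other index: Euler's identity for the derivative of F^2, which has degree
    one. Comparing the two contractions gives the symmetry of g. *)
Lemma sum_dir_gmx z j : D z ->
  \sum_i z.2 0 i * g_lo f i j z = 2^-1 * dy j (sqf f) z.
Proof.
move=> Dz; have hdq : homog D 1 (dy j (sqf f)) by exact: homog_dy.
rewrite -[dy j (sqf f) z]mul1r -(euler Dz (ddq j _ Dz) hdq) mulr_sumr.
by apply: eq_bigr => i _; rewrite /g_lo mxE mulrCA.
Qed.

(* The antisymmetric part of a 2x2 matrix is a multiple of a rotation, so it
   vanishes once it kills the nonzero vector y. *)
Lemma gmx_sym z : D z -> gmx f z 0 1 = gmx f z 1 0.
Proof.
move=> Dz; apply/eqP; rewrite -subr_eq0; apply/eqP.
have e i : \sum_j g_lo f i j z * z.2 0 j = \sum_j z.2 0 j * g_lo f j i z.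
  by rewrite sum_gmx_dir// sum_dir_gmx.
have := e 0; have := e 1; rewrite !big_ord2 /g_lo => e1 e0.
apply: contrapT => /eqP s0; have /eqP := dir_neq0 z Dz; apply.
apply/rowP; apply: ord2P; rewrite mxE; apply: (mulfI s0); rewrite mulr0.
- by apply/eqP; rewrite mulrBl subr_eq0; apply/eqP;
    apply: (addIr (z.2 0 1 * gmx f z 1 1)); rewrite [X in X + _ = _]mulrC -e1; ring.
- by apply/eqP; rewrite mulrBl subr_eq0; apply/eqP;
    apply: (addrI (z.2 0 0 * gmx f z 0 0)); rewrite [X in _ = _ + X]mulrC -e0; ring.
Qed.

(** The inverse metric is applied to g_jk y^k = (1/2) dF^2/dy^j. *)
Lemma sum_g_up_dy z i : D z ->
  \sum_j g_up f i j z * dy j (sqf f) z = 2 * z.2 0 i.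
Proof.
move=> Dz; rewrite -(sum_invmxl (gmx f z) (z.2 0) i (det0 _ Dz)) mulr_sumr.
apply: eq_bigr => j _.
by rewrite [X in _ * (_ * X)](sum_gmx_dir z j Dz) /g_up; field.
Qed.

Lemma sqr_signature z : D z -> signature f z * signature f z = 1.
Proof. by move=> Dz; rewrite -expr2 sqr_sg det0. Qed.

(* g^ij = l^i l^j + eps m^i m^j, multiplied by F^2. *)
Lemma g_up_frame z i j : D z ->
  f z ^+ 2 * g_up f i j z =
  z.2 0 i * z.2 0 j + f z ^+ 2 * signature f z * m_up f i z * m_up f j z.
Proof.
move=> Dz; pose n (k : 'I_2) : R := if k == 0 then - z.2 0 1 else z.2 0 0.
(* This is g(y,y) = F^2, the scalar in front of the inverse matrix in [invmx2_frame]. *)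
have E : \sum_k z.2 0 k * \sum_l gmx f z k l * z.2 0 l = f z ^+ 2.
  under eq_bigr do rewrite (sum_gmx_dir z _ Dz) mulrCA.
  by rewrite -mulr_sumr (euler Dz (dq _ Dz) hq) mulKf ?pnatr_eq0.
have [dz fz] := (det0 _ Dz, f0 _ Dz).
rewrite -E /g_up (invmx2_frame (gmx f z) (z.2 0) n) ?gmx_sym// E; congr (_ + _).
set s := Num.sqrt (signature f z * \det (gmx f z)).
(* The covector m is s/F times the rotated vector [n]; together with eps s^2 = det g this turns the
   determinant term into eps F^2 m^i m^j. *)
have mE k : m_up f k z = s / f z * \sum_l invmx (gmx f z) k l * n l.
  rewrite /m_up mulr_sumr; apply: eq_bigr => l _.
  rewrite /m_lo -/s /ell_up /g_up /n; by case: ifP => _; field.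
have s2 : signature f z * s ^+ 2 = \det (gmx f z).
  rewrite sqr_sqrtr; first by rewrite mulrA sqr_signature ?mul1r.
  by rewrite /signature -normrEsg.
by rewrite !mE -s2; field.
Qed.

End LocalFrame.

(** * The conformal change in one chart *)

Section LocalConformal.
Context {R : realType} {D : set ('rV[R]_2 * 'rV[R]_2)}.
Context {f fb ph : 'rV[R]_2 * 'rV[R]_2 -> R} {psi : 'rV[R]_2 -> R}.
Hypotheses (oD : open D)
  (coneD : forall c z, 0 < c -> D z -> D (z.1, c *: z.2))
  (sf : smooth_on D f) (hf : homog D 1 f)
  (f0 : forall z, D z -> f z != 0)
  (det0 : forall z, D z -> \det (gmx f z) != 0)
  (dpsi : forall z, D z -> differentiable psi z.1)
  (ddpsi : forall h z, D z -> differentiable (fun x => 'D_h psi x) z.1)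
  (phE : forall z, D z -> ph z = psi z.1)
  (fbE : forall z, D z -> fb z = expR (psi z.1) * f z).
Implicit Types z : 'rV[R]_2 * 'rV[R]_2.

Let e2 (x : 'rV[R]_2) : R := expR (2 * psi x).

Let e2E x : expR (2 * psi x) = expR (psi x) ^+ 2.
Proof. by rewrite -expRM_natl. Qed.

Let expRK2 x : expR (2 * psi x) * expR (- psi x) = expR (psi x).
Proof. by rewrite -expRD; congr expR; ring. Qed.

Let d2psi z : D z -> differentiable (fun x => 2 * psi x) z.1.
Proof. by move=> Dz; exact: (differentiableZ 2 (dpsi _ Dz)). Qed.

Let de1 z : D z -> differentiable (fun x => expR (psi x)) z.1.
Proof. by move=> Dz; apply: differentiable_expR; exact: dpsi. Qed.

Let de2 z : D z -> differentiable e2 z.1.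
Proof. by move=> Dz; apply: differentiable_expR; exact: d2psi. Qed.

Let sq : smooth_on D (sqf f). Proof. exact: smooth_onX2. Qed.

Let df (u : 'rV[R]_2 * 'rV[R]_2 -> R) : smooth_on D u ->
  forall z, D z -> differentiable u z.
Proof. by move=> su z Dz; exact: smooth_on_diff su. Qed.

(** Since [D] is open, an identity on [D] holds near each of its points. The conclusion again holds
    on all of [D], so the rule can be iterated. *)
Let dy_fibre (e : 'rV[R]_2 -> R) (u v : 'rV[R]_2 * 'rV[R]_2 -> R) z i :
  D z -> (forall z, D z -> differentiable e z.1) ->
  (forall z, D z -> differentiable u z) -> (forall z, D z -> v z = e z.1 * u z) ->
  dy i v z = e z.1 * dy i u z.
Proof.
move=> Dz de du vE; apply: derive_fibre_mul_base; [exact: de|exact: du|].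
exact: near_open vE.
Qed.

Lemma sqf_conformal z : D z -> sqf fb z = expR (2 * psi z.1) * sqf f z.
Proof. by move=> Dz; rewrite /sqf fbE// exprMn e2E. Qed.

Lemma dy_sqf_conformal z i : D z ->
  dy i (sqf fb) z = expR (2 * psi z.1) * dy i (sqf f) z.
Proof.
by move=> Dz; apply: (dy_fibre e2) => //; [exact: df|exact: sqf_conformal].
Qed.

Lemma gmx_conformal z : D z -> gmx fb z = expR (2 * psi z.1) *: gmx f z.
Proof.
move=> Dz; apply/matrixP => i j; rewrite !mxE mulrCA; congr (_ * _).
(* Second use of the fibre rule, now on the first derivative of F^2. *)
apply: (dy_fibre e2) => //; last by move=> x Dx; exact: dy_sqf_conformal.
by apply: df; exact: smooth_on_derive.
Qed.

Lemma g_lo_conformal z i j : D z ->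
  g_lo fb i j z = expR (2 * psi z.1) * g_lo f i j z.
Proof. by move=> Dz; rewrite /g_lo gmx_conformal// mxE. Qed.

Lemma g_up_conformal z i j : D z ->
  g_up fb i j z = (expR (2 * psi z.1))^-1 * g_up f i j z.
Proof.
move=> Dz; rewrite /g_up gmx_conformal// invmxZ ?mxE//.
by rewrite unitmxE detZ unitfE mulf_neq0 ?det0// expf_neq0// expR_eq0.
Qed.

Lemma ell_up_conformal z i :
  D z -> ell_up fb i z = expR (- psi z.1) * ell_up f i z.
Proof. by move=> Dz; rewrite /ell_up fbE// invfM expRN mulrCA. Qed.

Lemma ell_lo_conformal z i : D z -> ell_lo fb i z = expR (psi z.1) * ell_lo f i z.
Proof.
by move=> Dz; apply: (dy_fibre (fun x => expR (psi x))) => //; exact: df.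
Qed.

Lemma angular_conformal z i j : D z ->
  angular fb i j z = expR (2 * psi z.1) * angular f i j z.
Proof.
move=> Dz; rewrite /angular fbE//.
rewrite (dy_fibre (fun x => expR (psi x)) (dy j f))//.
- by rewrite e2E expr2 mulrACA.
- by apply: df; exact: smooth_on_derive.
- by move=> x Dx; exact: ell_lo_conformal.
Qed.

Lemma det_gmx_conformal z : D z ->
  \det (gmx fb z) = expR (2 * psi z.1) ^+ 2 * \det (gmx f z).
Proof. by move=> Dz; rewrite gmx_conformal// detZ. Qed.

Lemma signature_conformal z : D z -> signature fb z = signature f z.
Proof.
move=> Dz; rewrite /signature [in LHS](det_gmx_conformal _ Dz).
by rewrite (sgrM (_ ^+ 2)) (gtr0_sg (exprn_gt0 2 (expR_gt0 _))) mul1r.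
Qed.

Lemma m_lo_conformal z i : D z -> m_lo fb i z = expR (psi z.1) * m_lo f i z.
Proof.
move=> Dz; rewrite /m_lo [in LHS](signature_conformal _ Dz).
rewrite [in LHS](det_gmx_conformal _ Dz).
(* The root of the determinant gains e^{2 psi} and l^i gains e^{-psi}, which leaves e^{psi}. *)
rewrite (mulrCA (signature f z)) (sqrtrM _ (sqr_ge0 (expR _))) sqrtr_sqr.
rewrite (ger0_norm (expR_ge0 _)) !(ell_up_conformal _ _ Dz) -(expRK2 z.1).
by case: ifP => _; rewrite ?mulrN mulrACA.
Qed.

Lemma m_up_conformal z i : D z -> m_up fb i z = expR (- psi z.1) * m_up f i z.
Proof.
move=> Dz; rewrite /m_up mulr_sumr; apply: eq_bigr => j _.
rewrite [in LHS](g_up_conformal _ _ _ Dz) [in LHS](m_lo_conformal _ _ Dz).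
rewrite mulrACA; congr (_ * _).
by rewrite -expRN -expRD; congr expR; ring.
Qed.

Let dg_lo i j z : D z -> differentiable (g_lo f i j) z.
Proof.
move=> Dz; have -> : g_lo f i j = 2^-1 \*: dy i (dy j (sqf f)).
  by apply/funext => x; rewrite /g_lo mxE.
apply: differentiableZ; apply: df => //.
by do 2 apply: smooth_on_derive.
Qed.

Lemma cartan_conformal z i j k : D z ->
  cartan fb i j k z = expR (2 * psi z.1) * cartan f i j k z.
Proof.
move=> Dz; rewrite /cartan mulrCA; congr (_ * _).
by apply: (dy_fibre e2) => //; [exact: dg_lo|move=> x Dx; exact: g_lo_conformal].
Qed.

Lemma cartan_up_conformal z i j k : D z ->
  cartan_up fb i j k z = cartan_up f i j k z.
Proof.
move=> Dz; apply: eq_bigr => h _.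
rewrite [in LHS](g_up_conformal _ _ _ Dz) [in LHS](cartan_conformal _ _ _ _ Dz).
by rewrite mulrACA (mulVf (lt0r_neq0 (expR_gt0 _))) mul1r.
Qed.

(** The two defining equations differ by the nonzero factor e^{3 psi}, so they have the same
    solutions and [get] selects the same one. *)
Lemma main_scalar_conformal z : D z -> main_scalar fb z = main_scalar f z.
Proof.
move=> Dz; rewrite /main_scalar; congr (get _); apply/seteqP.
have e0 : expR (psi z.1) ^+ 3 != 0 by rewrite expf_neq0// expR_eq0.
suff E I i j k :
    (fb z * cartan fb i j k z = I * m_lo fb i z * m_lo fb j z * m_lo fb k z) <->
    (f z * cartan f i j k z = I * m_lo f i z * m_lo f j z * m_lo f k z).
  by split=> I H i j k; apply/E.
rewrite fbE// (cartan_conformal _ _ _ _ Dz) !(m_lo_conformal _ _ Dz) e2E.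
move: (expR _) (f z) (cartan f i j k z) (m_lo f i z) (m_lo f j z) (m_lo f k z) e0.
move=> e F C mi mj mk e0.
have -> : e * F * (e ^+ 2 * C) = e ^+ 3 * (F * C) by ring.
have -> : I * (e * mi) * (e * mj) * (e * mk) = e ^+ 3 * (I * mi * mj * mk) by ring.
by split=> [/(mulfI e0)|->].
Qed.

(** Position derivatives also act on e^{2 psi}; this is the source of the extra terms of the
    spray. *)
Lemma dx_sqf_conformal z i : D z -> dx i (sqf fb) z =
  expR (2 * psi z.1) * (dx i (sqf f) z + 2 * 'D_(delta_mx 0 i) psi z.1 * sqf f z).
Proof.
move=> Dz; rewrite /dx (derive_mul_base e2 (sqf f)).
- rewrite derive_expR_comp; last exact: d2psi.
  have -> : 'D_(delta_mx 0 i) (fun x => 2 * psi x) z.1 =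
      2 * 'D_(delta_mx 0 i) psi z.1.
    by rewrite (@deriveZ _ _ _ psi 2)//; apply: diff_derivable; exact: dpsi.
  by rewrite mulrDr !mulrA.
- exact: de2.
- exact: df.
- exact: (near_open oD Dz sqf_conformal).
Qed.

Lemma dy_dx_sqf_conformal z i j : D z -> dy j (dx i (sqf fb)) z =
  expR (2 * psi z.1) * (dy j (dx i (sqf f)) z +
    2 * 'D_(delta_mx 0 i) psi z.1 * dy j (sqf f) z).
Proof.
move=> Dz; pose c (x : 'rV[R]_2) := 2 * 'D_(delta_mx 0 i) psi x.
have dc : differentiable c z.1 by exact: (differentiableZ 2 (ddpsi _ _ Dz)).
have d1 : differentiable (dx i (sqf f)) z.
  by apply: df => //; exact: smooth_on_derive.
have d2 : differentiable (fun x => c x.1 * sqf f x) z.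
  apply: (@differentiableM _ _ (fun x => c x.1) (sqf f)); last exact: df.
  exact: differentiable_comp_fst.
rewrite {1}/dy (derive_fibre_mul_base e2
  (dx i (sqf f) \+ (fun x => c x.1 * sqf f x))).
- congr (_ * _); rewrite deriveD; try exact: diff_derivable.
  congr (_ + _); rewrite (derive_fibre_mul_base c (sqf f))//; first exact: df.
  exact: (near_open oD Dz).
- exact: de2.
- exact: differentiableD.
- by apply: (near_open oD Dz) => x Dx; exact: dx_sqf_conformal.
Qed.

Lemma dx_base z i : D z -> dx i ph z = 'D_(delta_mx 0 i) psi z.1.
Proof.
move=> Dz; rewrite /dx (near_eq_derive _ (near_open oD Dz phE)).
by apply: derive_comp_fst; exact: dpsi.
Qed.

Lemma dy_base z i : D z -> dy i ph z = 0.
Proof.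
move=> Dz; rewrite /dy (near_eq_derive _ (near_open oD Dz phE)).
by rewrite derive_comp_fst ?deriveE ?linear0//; exact: dpsi.
Qed.

(** The nonlinear connection enters only through fibre derivatives, and these vanish on a function
    of position. *)
Lemma delta_base z i : D z -> delta f i ph z = 'D_(delta_mx 0 i) psi z.1.
Proof.
move=> Dz; rewrite /delta dx_base// big1 ?subr0// => j _.
by rewrite dy_base// mulr0.
Qed.

Lemma spray_conformal z i : D z -> spray fb i z = spray f i z +
  2^-1 * f z ^+ 2 *
    (hder1 f ph z * ell_up f i z - hder2 f ph z * m_up f i z).
Proof.
move=> Dz; pose y := z.2 0; pose p k := 'D_(delta_mx 0 k) psi z.1.
pose T j := \sum_k y k * dy j (dx k (sqf f)) z - dx j (sqf f) z.
have TE j : \sum_k y k * dy j (dx k (sqf fb)) z - dx j (sqf fb) z =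
    expR (2 * psi z.1) * (T j + 2 * (\sum_k y k * p k) * dy j (sqf f) z
      - 2 * p j * f z ^+ 2).
  rewrite [in LHS](dx_sqf_conformal _ j Dz).
  under eq_bigr do rewrite (dy_dx_sqf_conformal _ _ j Dz).
  (* Stated for arbitrary scalars, so that [ring] meets letters instead of derivatives; the later
     [alg] facts serve the same purpose. *)
  have alg (c N Q s pj : R) (M q : 'I_2 -> R) :
      \sum_k y k * (c * (M k + 2 * q k * Q)) - c * (N + 2 * pj * s) =
      c * (\sum_k y k * M k - N + 2 * (\sum_k y k * q k) * Q - 2 * pj * s).
    by rewrite !big_ord2; ring.
  exact: alg.
(* The factors e^{-2 psi} and e^{2 psi} cancel. F^2 stays next to g^ij, ready for [g_up_frame]. *)
have sprayE : spray fb i z = spray f i z +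
    4^-1 * (2 * (\sum_k y k * p k) * (\sum_j g_up f i j z * dy j (sqf f) z)
      - 2 * \sum_j p j * (f z ^+ 2 * g_up f i j z)).
  have alg (c s F : R) (G Q S q : 'I_2 -> R) : c != 0 ->
      4^-1 * \sum_j c^-1 * G j * (c * (S j + 2 * s * Q j - 2 * q j * F)) =
      4^-1 * (\sum_j G j * S j) +
      4^-1 * (2 * s * (\sum_j G j * Q j) - 2 * \sum_j q j * (F * G j)).
    by move=> c0; rewrite !big_ord2; field.
  rewrite {1}/spray; under eq_bigr do
    rewrite -/(y _) [X in _ * X]TE [X in X * _](g_up_conformal _ _ _ Dz).
  exact: alg (lt0r_neq0 (expR_gt0 _)).
(* With both contractions inserted, y^i (y^k psi_k) loses half of itself to the y^i y^j part of F^2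
   g^ij; the rest is the m-term. *)
have alg (F eps yi mi : R) (q m : 'I_2 -> R) : F != 0 ->
    4^-1 * (2 * (\sum_k y k * q k) * (2 * yi) -
      2 * \sum_j q j * (yi * y j + F ^+ 2 * eps * mi * m j)) =
    2^-1 * F ^+ 2 * ((\sum_k q k * (y k / F)) * (yi / F) -
      eps * (\sum_k q k * m k) * mi).
  by move=> F0; rewrite !big_ord2; field.
have frameE : \sum_j p j * (f z ^+ 2 * g_up f i j z) = \sum_j p j *
    (z.2 0 i * y j + f z ^+ 2 * signature f z * m_up f i z * m_up f j z).
  by apply: eq_bigr => j _; rewrite (g_up_frame oD coneD sf hf f0 det0 z i j Dz).
have hder1E : hder1 f ph z = \sum_k p k * (y k / f z).
  by apply: eq_bigr => k _; rewrite (delta_base _ _ Dz).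
have hder2E : hder2 f ph z = signature f z * \sum_k p k * m_up f k z.
  by congr (_ * _); apply: eq_bigr => k _; rewrite (delta_base _ _ Dz).
rewrite sprayE (sum_g_up_dy oD sf hf det0 z i Dz) frameE hder1E hder2E.
by rewrite (alg _ _ _ _ p (fun j => m_up f j z) (f0 _ Dz)).
Qed.

End LocalConformal.

(** * Passage from the surface to the image of one chart *)

Theorem proposition5p5 (R : realType) (M : smooth_surface R)
    (A : set (tangent M)) (F : tangent M -> R) (phi : M -> R)
    (FA : conic_pseudo_finsler A F) (sphi : smooth_function phi)
    (a : atlas M) (w : tangent M) (Aw : A w) (aw : dom a (base w)) :
  let Phi := fun v : tangent M => phi (base v) in
  let Fb := fun v : tangent M => expR (Phi v) * F v in
  let f := loc a F in
  let fb := loc a Fb in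
  let ph := loc a Phi in
  let z := coords a w in
  (* (i) *)
  ((forall i j, g_lo fb i j z = expR (2 * Phi w) * g_lo f i j z) /\
   (forall i j, g_up fb i j z = expR (- (2 * Phi w)) * g_up f i j z)) /\
  (* (ii) *)
  ((forall i, ell_up fb i z = expR (- Phi w) * ell_up f i z) /\
   (forall i, ell_lo fb i z = expR (Phi w) * ell_lo f i z)) /\
  (* (iii) *)
  ((forall i, m_lo fb i z = expR (Phi w) * m_lo f i z) /\
   (forall i, m_up fb i z = expR (- Phi w) * m_up f i z) /\
   (forall i j, angular fb i j z = expR (2 * Phi w) * angular f i j z)) /\
  (* (iv) *)
  ((forall i j k, cartan fb i j k z = expR (2 * Phi w) * cartan f i j k z) /\
   (forall i j k, cartan_up fb i j k z = cartan_up f i j k z) /\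
   main_scalar fb z = main_scalar f z) /\
  (* (v) *)
  (forall i, spray fb i z = spray f i z +
     2^-1 * f z ^+ 2 *
       (hder1 f ph z * ell_up f i z - hder2 f ph z * m_up f i z)).
Proof.
move=> Phi Fb f fb ph z.
have [[oA _ _ _ cA] sF hF dF nF] := FA.
pose D := coord_image a A; pose psi := phi \o unchart a.
have Dz : D z by exists w.
have oD : open D := oA a.
(* Scaling is done on the tangent vector itself, where the cone condition on [A] applies, and then
   read in the chart. *)
have coneD c (x : 'rV[R]_2 * 'rV[R]_2) : 0 < c -> D x -> D (x.1, c *: x.2).
  move=> c0 [v [Av av] <-]; have [u uv] := scaled_exists c v.
  exists u; first by split; [exact: cA uv Av|rewrite uv.1].
  by rewrite /coords uv.1 uv.2.
have sf : smooth_on D f := sF a.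
have hf : homog D 1 f.
  move=> c x c0 [v [Av av] <-]; have [u uv] := scaled_exists c v.
  have -> : ((coords a v).1, c *: (coords a v).2) = coords a u.
    by rewrite /coords uv.1 uv.2.
  by rewrite /f !loc_coords ?uv.1// (hF c v u).
have f0 x : D x -> f x != 0.
  by move=> [v [Av av] <-]; rewrite /f loc_coords// nF.
have det0 x : D x -> \det (gmx f x) != 0 := dF a x.
have chartD x : D x -> (chart a @` dom a) x.1.
  by move=> [v [_ av] <-]; exists (base v).
have dpsi x : D x -> differentiable psi x.1.
  by move=> /chartD Ux; exact: smooth_on_diff Ux (sphi a).
have ddpsi h x : D x -> differentiable (fun t => 'D_h psi t) x.1.
  by move=> /chartD Ux; exact: smooth_on_diff Ux (smooth_on_derive h (sphi a)).
have psiE v : dom a (base v) -> psi (coords a v).1 = Phi v.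
  by move=> av; rewrite /psi/= chartK.
(* [loc] is meaningful only at coordinates of tangent vectors, so this and the next identity are
   restricted to [D]. *)
have phE x : D x -> ph x = psi x.1.
  by move=> [v [Av av] <-]; rewrite /ph loc_coords// psiE.
have fbE x : D x -> fb x = expR (psi x.1) * f x.
  by move=> [v [Av av] <-]; rewrite /fb /f !loc_coords// psiE.
rewrite -(psiE w aw) -/z; split; [split|
  split; [split|split; [split; [|split]|split; [split; [|split]|]]]].
- by move=> i j; exact: (g_lo_conformal oD sf dpsi fbE z i j Dz).
- by move=> i j; rewrite expRN; exact: (g_up_conformal oD sf det0 dpsi fbE z i j Dz).
- by move=> i; exact: (ell_up_conformal fbE z i Dz).
- by move=> i; exact: (ell_lo_conformal oD sf dpsi fbE z i Dz).
- by move=> i; exact: (m_lo_conformal oD sf dpsi fbE z i Dz).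
- by move=> i; exact: (m_up_conformal oD sf det0 dpsi fbE z i Dz).
- by move=> i j; exact: (angular_conformal oD sf dpsi fbE z i j Dz).
- by move=> i j k; exact: (cartan_conformal oD sf dpsi fbE z i j k Dz).
- by move=> i j k; exact: (cartan_up_conformal oD sf det0 dpsi fbE z i j k Dz).
- exact: (main_scalar_conformal oD sf dpsi fbE z Dz).
- move=> i.
  exact: (spray_conformal oD coneD sf hf f0 det0 dpsi ddpsi phE fbE z i Dz).
Qed.
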